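(* Let $p\ge 2$ and let $G$ be a finite simple non-connected graph with connected components $G_1,G_2,\ldots,G_p$ of diameters $d_1,d_2,\ldots,d_p$, respectively. Let $d_{\max}=\max_i d_i$, and suppose that $d_{\max}\ge 1$ and that $|V(G_i)|=n$ for each $i$. Then $G$ is $\{0,1,\ldots,d_{\max}\}$-distance magic if and only if $n$ is even or both $n$ and $p$ are odd.
   Context: Let $G=(V,E)$ be a finite simple undirected graph with $v=|V|$ vertices, and let $d(x,y)$ be the graph distance (vertices in different connected components are at infinite distance). For a set $D$ of nonnegative integers and $x\in V$, put $N_D(x)=\{y\in V : d(x,y)\in D\}$. A $D$-distance magic labeling of $G$ is a bijection $f:V\to\{1,2,\ldots,v\}$ for which there is a constant $\mathsf{k}$ such that $\sum_{y\in N_D(x)} f(y)=\mathsf{k}$ for every $x\in V$. $G$ is called $D$-distance magic if it admits a $D$-distance magic labeling. *)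

(* Defs.v *)
From mathcomp Require Import all_boot.

Set Implicit Arguments.
Unset Strict Implicit.
Unset Printing Implicit Defensive.

Record sgraph := SGraph {
  vertex :> finType;
  edge : rel vertex;
  edge_sym : symmetric edge;
  edge_irr : irreflexive edge }.

Arguments edge {s} x y.

Definition walk (G : sgraph) (k : nat) (x y : G) : bool :=
  [exists s : k.-tuple G, path edge x s && (last x s == y)].

Lemma connect_walk (G : sgraph) (x y : G) :
  connect edge x y -> exists k, walk k x y.
Proof.
case/connectP=> s es ys; exists (size s).
by apply/existsP; exists (in_tuple s); rewrite es ys /=.
Qed.

Lemma walk_connect (G : sgraph) (k : nat) (x y : G) :
  walk k x y -> connect edge x y.
Proof.
by case/existsP=> s /andP[es /eqP ys]; apply/connectP; exists s.
Qed.

(* [None] stands for infinite distance. *)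
Definition dist (G : sgraph) (x y : G) : option nat :=
  match @idP (connect edge x y) with
  | ReflectT h => Some (ex_minn (connect_walk h))
  | ReflectF _ => None
  end.

Lemma dist_SomeP (G : sgraph) (x y : G) (k : nat) :
  dist x y = Some k <-> walk k x y /\ (forall j, walk j x y -> k <= j).
Proof.
rewrite /dist; case: {-}_ / idP => [h|nh].
  case: ex_minnP => m wm minm; split=> [[<-] //|[wk mink]].
  by congr Some; apply/eqP; rewrite eqn_leq minm // mink.
by split=> // -[/walk_connect].
Qed.

Lemma dist_NoneP (G : sgraph) (x y : G) :
  dist x y = None <-> ~~ connect edge x y.
Proof. by rewrite /dist; case: {-}_ / idP => [h|/negP h]; rewrite ?h. Qed.

(* [None] stands for infinite diameter, i.e. for a disconnected graph. *)
Definition diam (G : sgraph) : option nat :=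
  if [forall x : G, forall y : G, dist x y != None]
  then Some (\max_(x : G) \max_(y : G) odflt 0 (dist x y))
  else None.

Section Induced.
Variables (G : sgraph) (A : {set G}).

Definition induced_edge : rel {x : G | x \in A} :=
  fun x y => edge (val x) (val y).

Lemma induced_sym : symmetric induced_edge.
Proof. by move=> x y; apply: edge_sym. Qed.

Lemma induced_irr : irreflexive induced_edge.
Proof. by move=> x; apply: edge_irr. Qed.

Definition induced : sgraph := SGraph induced_sym induced_irr.
End Induced.

Definition components (G : sgraph) : {set {set G}} :=
  equivalence_partition (connect edge) [set: G].

Definition D_neighborhood (G : sgraph) (D : pred nat) (x : G) : {set G} :=
  [set y | if dist x y is Some k then D k else false].

Definition is_labeling (G : sgraph) (f : G -> nat) : Prop :=
  injective f /\ (forall m, (exists x, f x = m) <-> 1 <= m <= #|G|).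

Definition is_magic_labeling (G : sgraph) (D : pred nat) (f : G -> nat) : Prop :=
  is_labeling f /\
  exists k : nat, forall x : G, \sum_(y in D_neighborhood D x) f y = k.

Definition distance_magic (G : sgraph) (D : pred nat) : Prop :=
  exists f : G -> nat, is_magic_labeling D f.

(* Main.v *)
Require Import Defs.
From mathcomp Require Import all_boot.
From mathcomp Require Import zify.

Set Implicit Arguments.
Unset Strict Implicit.
Unset Printing Implicit Defensive.

(** Inside one component the distance never exceeds [\max_i d i], and between
    two components it is infinite, so the neighbourhood of a vertex is exactly
    its component ([D_neighborhood_component]).  The graph structure then
    disappears: the question is whether [1, .., n * p] can be distributed over
    [p] blocks of size [n] with equal block sums.

    Necessity is double counting: if every block sums to [k], then
    [2 * p * k = n * p * (n * p + 1)], and for odd [n] this makes [p] odd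
    ([equal_block_sums_odd]).

    Sufficiency rests on a Kotzig array: [n] permutations of [0, .., p - 1],
    written as the rows of an array, whose column sums all agree
    ([kotzig_array]).  Adding [j * p + 1] to row [j] turns the array into a
    bijection onto [1, .., n * p] without disturbing the equality of the column
    sums, and column [i] is used to label the [i]-th block
    ([equal_block_sums_labeling]).  Two rows, increasing and decreasing, can
    always be appended to a Kotzig array; so the array exists for even [n]
    starting from no row, and for odd [n] and [p] starting from three rows.
    For [p >= 2] a single row never works, so [n = 1] has to be excluded; here
    [n = 1] would force all diameters to vanish. *)

(** * Components as neighbourhoods *)

Lemma mem_component (G : sgraph) (A : {set G}) (x y : G) :
  A \in components G -> x \in A -> (y \in A) = connect edge x y.
Proof.
have edge_csym := sym_connect_sym (@edge_sym G).
case/imsetP=> z _ ->; rewrite !inE => zx.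
exact: same_connect zx y.
Qed.

Lemma induced_walk (G : sgraph) (A : {set G}) k (x y : induced A) :
  walk k x y -> walk k (val x) (val y).
Proof.
case/existsP=> s /andP[es /eqP <-].
by apply/existsP; exists (map_tuple val s); rewrite /= last_map eqxx path_map es.
Qed.

(** A shortest walk inside the induced subgraph is a walk of the whole graph, so
    the diameter of the component bounds distances in the whole graph. *)
Lemma D_neighborhood_component (G : sgraph) (A : {set G}) (m e : nat) (x : G) :
  A \in components G -> diam (induced A) = Some e -> e <= m -> x \in A ->
  D_neighborhood [pred k | k <= m] x = A.
Proof.
move=> AG diamA lem xA; apply/setP=> y; rewrite inE.
apply/idP/idP=> [|yA].
  case dxy: (dist x y) => [k|//] _; rewrite (mem_component y AG xA).
  by have /dist_SomeP[/walk_connect] := dxy.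
have := mem_component y AG xA; rewrite yA => /esym xy.
case dxy: (dist x y) => [k|]; last by move/dist_NoneP: dxy; rewrite xy.
have /dist_SomeP[_ mink] := dxy.
move: diamA; rewrite /diam; case: ifP => // /forallP finA [def_e].
pose x' : induced A := exist _ x xA; pose y' : induced A := exist _ y yA.
have := forallP (finA x') y'.
case dxy': (dist x' y') => [l|//] _.
have /dist_SomeP[/induced_walk/mink lekl _] := dxy'.
apply: leq_trans lekl (leq_trans _ lem); rewrite -def_e.
apply: leq_trans (leq_bigmax x'); apply: leq_trans (leq_bigmax y').
by rewrite dxy'.
Qed.

Lemma diam_le_card (G : sgraph) e : #|G| <= 1 -> diam G = Some e -> e = 0.
Proof.
move/fintype_le1P=> G1; rewrite /diam; case: ifP => // _ [<-].
apply: big1 => x _; apply: big1 => y _; rewrite (G1 y x).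
case dyy: (dist y y) => [k|//] /=.
have /dist_SomeP[_ mink] := dyy; apply/eqP; rewrite -leqn0; apply: mink.
by apply/existsP; exists [tuple]; rewrite /= eqxx.
Qed.

(** Describing the components as the fibres of one map makes their disjointness
    and covering available to the partition lemmas on big operators. *)
Lemma components_indexing (G : sgraph) p (C : 'I_p -> {set G}) :
  injective C -> [set C i | i : 'I_p] = components G ->
  exists c : G -> 'I_p, forall i, C i = [set x | c x == i].
Proof.
move=> Cinj CG.
have CiG i : C i \in components G by rewrite -CG imset_f.
have Cx (x : G) : exists i, x \in C i.
  have: [set y in [set: G] | connect edge x y] \in components G.
    by apply/imsetP; exists x.
  rewrite -CG => /imsetP[i _ defC]; exists i.
  by rewrite -defC !inE connect0.
exists (fun x => xchoose (Cx x)) => i; apply/setP=> x; rewrite inE.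
have xCc := xchooseP (Cx x).
apply/idP/eqP=> [xC|<-//]; apply/Cinj/setP=> y.
by rewrite (mem_component y (CiG _) xCc) (mem_component y (CiG i) xC).
Qed.

(** * Labelings with equal block sums *)

Lemma injective_label_bij (T : finType) (f : T -> nat) :
  injective f -> (forall x, 0 < f x <= #|T|) ->
  exists2 g : T -> 'I_#|T|, bijective g & forall x, f x = (g x).+1.
Proof.
move=> finj fP.
have ltf x : (f x).-1 < #|T| by have := fP x; lia.
exists (fun x => Ordinal (ltf x)) => [|x /=]; last by have := fP x; lia.
apply: inj_card_bij; last by rewrite card_ord.
by move=> x y [] exy; apply: finj; have := fP x; have := fP y; lia.
Qed.

Lemma sum_labeling (G : sgraph) (f : G -> nat) :
  is_labeling f -> 2 * \sum_x f x = #|G| * #|G|.+1.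
Proof.
case=> finj fim.
have [|g gbij fg] := injective_label_bij finj; first by move=> x; apply/fim; exists x.
have -> : \sum_x f x = \sum_(i < #|G|) i.+1.
  rewrite (reindex g); last exact: onW_bij.
  by apply: eq_bigr => x _; rewrite fg.
elim: #|G| => [|v IHv]; first by rewrite big_ord0.
by rewrite big_ord_recr /= mulnDr IHv; lia.
Qed.

Lemma card_blocks (T : finType) p n (c : T -> 'I_p) :
  (forall i, #|[set x | c x == i]| = n) -> #|T| = n * p.
Proof.
move=> cn; rewrite -sum1_card (partition_big c predT) //=.
rewrite (eq_bigr (fun=> n)) => [|i _]; first by rewrite sum_nat_const card_ord mulnC.
by rewrite -(cn i) -sum1_card; apply: eq_bigl => x; rewrite inE.
Qed.

(** If all blocks sum to [k], then [2 * p * k = n * p * (n * p + 1)]; cancelling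
    [p] leaves [n * (n * p + 1)] even. *)
Lemma equal_block_sums_odd (G : sgraph) p n (c : G -> 'I_p) (f : G -> nat) k :
  0 < p -> (forall i, #|[set x | c x == i]| = n) -> is_labeling f ->
  (forall i, \sum_(x | c x == i) f x = k) -> odd n -> odd p.
Proof.
move=> p_gt0 cn /sum_labeling; rewrite (card_blocks cn) => sumf fk n_odd.
have{sumf} : 2 * (p * k) = n * p * (n * p).+1.
  rewrite -sumf (partition_big c predT) //=.
  by rewrite (eq_bigr (fun=> k)) // sum_nat_const card_ord.
have -> : n * p * (n * p).+1 = p * (n * (n * p).+1) by lia.
rewrite mulnCA => /eqP; rewrite eqn_pmul2l // => /eqP/(congr1 odd).
by rewrite !oddM /= oddM n_odd; case: (odd p).
Qed.

(** * Kotzig arrays *)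

(** The second row of the three-row array.  With [p = 2 * q + 1], even columns
    take the values [q, .., 0] and odd columns the values [2 * q, .., q + 1];
    the third row, [3 * q - i - kotzig_row p i], then takes the values
    [2 * q, .., q] on even columns and [q - 1, .., 0] on odd ones, so it is a
    permutation as well. *)
Definition kotzig_row (p i : nat) : nat :=
  if odd i then p.-1 - i./2 else p./2 - i./2.

(** [r j] is row [j] of the array, a permutation of the columns.  Induction on [n]
    by steps of two: the appended rows [i] and [p - 1 - i] contribute [p - 1] to
    every column. *)
Lemma kotzig_array p n : n <> 1 -> (odd n -> odd p) ->
  exists r : nat -> 'I_p -> 'I_p, (forall j, injective (r j)) /\
    exists k, forall i, \sum_(j < n) r j i = k.
Proof.
case: p => [|p].
  by move=> _ _; exists (fun _ i => i); split=> [_ ? ? //|]; exists 0; case.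
elim/ltn_ind: n => -[|[|n]] // IHn _ n_odd.
  by exists (fun _ i => i); split=> [_ ? ? //|]; exists 0 => i; rewrite big_ord0.
case: (n =P 1) => [n1|n_neq1]; last first.
  have n_odd' : odd n -> odd p.+1 by move: n_odd; rewrite /= negbK.
  have [r [rinj [k rk]]] := IHn n (leqnSn n.+1) n_neq1 n_odd'.
  exists (fun j i => if j < n then r j i else if j == n then i else rev_ord i).
  split=> [j|].
    by case: (j < n) => //; case: (j == n) => // x y /rev_ord_inj.
  exists (k + p) => i; rewrite !big_ord_recr /= ltnn eqxx ltnNge leqnSn /=.
  rewrite gtn_eqF // -(rk i); under eq_bigr => l _ do rewrite ltn_ord.
  by rewrite -addnA /= subSS subnKC // -ltnS.
(* Three rows: [p.+1] is odd, and each column sums to [3 * q] with [q = p./2]. *)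
have {}n_odd : odd p.+1 by apply: n_odd; rewrite n1.
have lt2 (i : 'I_p.+1) : kotzig_row p.+1 i < p.+1.
  by have := ltn_ord i; rewrite /kotzig_row; case: ifP; lia.
have lt3 (i : 'I_p.+1) : 3 * p./2 - i - kotzig_row p.+1 i < p.+1.
  by have := ltn_ord i; rewrite /kotzig_row; case: ifP; lia.
exists (fun j i => match j with
  | 0 => i | 1 => Ordinal (lt2 i) | _ => Ordinal (lt3 i) end).
split=> [[|[|j]] x y //|].
- move=> [] exy; apply: val_inj; move: exy => /=.
  have := ltn_ord x; have := ltn_ord y.
  by rewrite /kotzig_row; case: ifP; case: ifP; lia.
- move=> [] exy; apply: val_inj; move: exy => /=.
  have := ltn_ord x; have := ltn_ord y.
  by rewrite /kotzig_row; case: ifP; case: ifP; lia.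
exists (3 * p./2) => i; rewrite n1 !big_ord_recr big_ord0 /=.
by have := ltn_ord i; rewrite /kotzig_row; case: ifP; lia.
Qed.

(** A vertex is addressed by its block [c x], a column of the array, and by its
    rank [j x] in the enumeration of that block, a row of the array.  Dividing
    its label, less one, by [p] recovers the row, and the remainder recovers the
    column because rows are permutations; so the labels are distinct. *)
Lemma equal_block_sums_labeling (G : sgraph) p n (c : G -> 'I_p) :
  (forall i, #|[set x | c x == i]| = n) -> n <> 1 -> (odd n -> odd p) ->
  exists2 f : G -> nat, is_labeling f &
    exists k, forall i, \sum_(x | c x == i) f x = k.
Proof.
move=> cn n_neq1 np; have [r [rinj [k rk]]] := kotzig_array n_neq1 np.
pose B i := enum [set x | c x == i].
have sizeB i : size (B i) = n by rewrite -cardE.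
have memB x : x \in B (c x) by rewrite mem_enum inE.
pose j x := index x (B (c x)).
have ltj x : j x < n by rewrite -(sizeB (c x)) index_mem.
pose f x := (j x * p + r (j x) (c x)).+1.
have finj : injective f.
  move=> x y [] exy.
  have p_gt0 : 0 < p := leq_ltn_trans (leq0n _) (ltn_ord (c x)).
  have ej : j x = j y.
    move/(congr1 (divn^~ p)): exy.
    by rewrite !divnMDl // !divn_small // !addn0.
  have ec : c x = c y.
    by move: exy; rewrite ej => /addnI/val_inj/rinj.
  by rewrite -[LHS](nth_index x (memB x)) -/(j x) ej ec nth_index.
have fP x : 0 < f x <= #|G|.
  rewrite (card_blocks cn) /=; apply: leq_trans (_ : (j x).+1 * p <= _).
    by rewrite mulSnr ltn_add2l.
  by rewrite leq_mul2r ltj orbT.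
exists f.
  split=> // m; split=> [[x <-] //|/andP[m_gt0 lem]].
  have [g [h _ gh] fg] := injective_label_bij finj fP.
  have ltm : m.-1 < #|G| by rewrite prednK.
  by exists (h (Ordinal ltm)); rewrite fg gh /= prednK.
exists (\sum_(l < n) (l * p).+1 + k) => i; rewrite -(rk i) -big_split /=.
rewrite (eq_bigl [in [set x | c x == i]]) => [|x]; last by rewrite inE.
rewrite big_enum_val /= -(cn i); apply: eq_bigr => l _.
have := enum_valP l; rewrite inE => /eqP cl.
have jl : j (enum_val l) = l.
  by rewrite /j cl {1}(enum_val_nth (enum_val l)) index_uniq ?enum_uniq // -cardE.
by rewrite /f jl cl.
Qed.

Theorem lemma9 (p n : nat) (G : sgraph) (C : 'I_p -> {set G}) (d : 'I_p -> nat)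
  (hp : 2 <= p)
  (hCinj : injective C)
  (hC : [set C i | i : 'I_p] = components G)
  (hd : forall i : 'I_p, diam (induced (C i)) = Some (d i))
  (hdmax : 1 <= \max_(i < p) d i)
  (hn : forall i : 'I_p, #|C i| = n) :
  distance_magic G [pred k | k <= \max_(i < p) d i] <->
  ~~ odd n \/ (odd n /\ odd p).
Proof.
have [c Cc] := components_indexing hCinj hC.
have cn i : #|[set x | c x == i]| = n by rewrite -Cc.
have n_neq1 : n <> 1.
  move=> n1; move: hdmax; rewrite big1 // => i _.
  apply: diam_le_card (hd i).
  by rewrite card_sig (eq_card (B := C i)) ?hn ?n1.
have nbhd (f : G -> nat) x : \sum_(y in D_neighborhood
    [pred k | k <= \max_(i < p) d i] x) f y = \sum_(y | c y == c x) f y.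
  rewrite (D_neighborhood_component _ (hd (c x))) ?Cc ?inE //.
  - by apply: eq_bigl => y; rewrite inE.
  - by rewrite -Cc -hC imset_f.
  - exact: leq_bigmax.
split=> [[f [flab [k fk]]]|np].
  case: (boolP (odd n)) => [n_odd|]; [right; split=> // | by left].
  apply: (equal_block_sums_odd (ltnW hp) cn flab (k := k)) => // i.
  have /set0Pn[x] : [set x | c x == i] != set0 by rewrite -card_gt0 cn odd_gt0.
  by rewrite inE => /eqP <-; rewrite -nbhd.
have [|f flab [k fk]] := equal_block_sums_labeling cn n_neq1.
  by case: np => [/negbTE->|[]].
by exists f; split=> //; exists k => x; rewrite nbhd.
Qed.
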